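(* Let $\mathcal{M}$ be an acyclic oriented matroid on a finite ground set $S$ with Las Vergnas face lattice $\mathcal{L}(\mathcal{M})$ and flat lattice $\mathcal{F}l(\mathcal{M})$. If all the elements of $\mathcal{M}$ are in $\mathcal{L}(\mathcal{M})$ (i.e. $\{s\}\in\mathcal{L}(\mathcal{M})$ for all $s\in S$), then for any facial building set $\mathcal{F}$ for $\mathcal{M}$, the $\mathcal{F}l(\mathcal{M})$-building closure $\mathcal{G}$ of $\mathcal{F}$ satisfies $\mathcal{G}\cap\mathcal{L}(\mathcal{M})=\mathcal{F}$.
   Context: An oriented matroid $\mathcal{M}$ on $S$ is acyclic if $(S,\varnothing)$ is a covector. A face of an acyclic $\mathcal{M}$ is a set $F\subseteq S$ such that $(S\setminus F,\varnothing)$ is a covector; faces ordered by inclusion form the Las Vergnas face lattice $\mathcal{L}(\mathcal{M})$. A flat of $\mathcal{M}$ is a set $S\setminus(v_+\cup v_-)$ for a covector $v=(v_+,v_-)$ of $\mathcal{M}$; flats ordered by inclusion form the flat lattice $\mathcal{F}l(\mathcal{M})$. Every face is a flat. For a finite lattice $\mathcal{L}$ with bottom $\hat 0$, an $\mathcal{L}$-building set is a subset $\mathcal{B}\subseteq\mathcal{L}_{>\hat 0}$ such that for every $Y\in\mathcal{L}_{>\hat 0}$, with $\{B_1,\dots,B_k\}=\max(\mathcal{B}_{\le Y})$, there is a poset isomorphism $\prod_{j}\mathcal{L}_{\le B_j}\to\mathcal{L}_{\le Y}$ whose $j$-th component is the inclusion. The $\mathcal{L}$-building closure of $\mathcal{X}\subseteq\mathcal{L}_{>\hat0}$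 is the unique inclusion-minimal $\mathcal{L}$-building set containing $\mathcal{X}$ (it exists). A facial building set for $\mathcal{M}$ is an $\mathcal{L}(\mathcal{M})$-building set. *)

(* Defs.v *)
From HB Require Import structures.
From mathcomp Require Import all_boot all_order.

Set Implicit Arguments.
Unset Strict Implicit.
Unset Printing Implicit Defensive.

Import Order.TTheory.

(* Signed subsets of S are pairs v = (v.1, v.2) = (v_+, v_-). *)

Section SignedSets.
Variable S : finType.
Implicit Types u v : {set S} * {set S}.

Definition support v : {set S} := v.1 :|: v.2.

Definition opp v : {set S} * {set S} := (v.2, v.1).

Definition comp u v : {set S} * {set S} :=
  (u.1 :|: (v.1 :\: u.2), u.2 :|: (v.2 :\: u.1)).

Definition sep u v : {set S} := (u.1 :&: v.2) :|: (u.2 :&: v.1).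

End SignedSets.

(* The standard covector axioms; cov_elim asks that w vanish at e and agree
   with comp u v outside sep u v. *)
Record orientedMatroid (S : finType) := OrientedMatroid {
  covectors : {set {set S} * {set S}};
  cov_disjoint : forall v, v \in covectors -> [disjoint v.1 & v.2];
  cov_zero : (set0, set0) \in covectors;
  cov_opp : forall v, v \in covectors -> opp v \in covectors;
  cov_comp : forall u v,
    u \in covectors -> v \in covectors -> comp u v \in covectors;
  cov_elim : forall u v e,
    u \in covectors -> v \in covectors -> e \in sep u v ->
    exists2 w, w \in covectors &
      [/\ e \notin support w,
          w.1 :\: sep u v = (comp u v).1 :\: sep u v &
          w.2 :\: sep u v = (comp u v).2 :\: sep u v]
}.

Definition acyclic (S : finType) (M : orientedMatroid S) : bool :=
  (setT, set0) \in covectors M.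

Definition faces (S : finType) (M : orientedMatroid S) : {set {set S}} :=
  [set F : {set S} | (~: F, set0) \in covectors M].

Definition flats (S : finType) (M : orientedMatroid S) : {set {set S}} :=
  [set ~: support v | v in covectors M].

(* Families of subsets containing the ground set and closed under
   intersection: ordered by inclusion, they are finite lattices. *)
Record mooreFamily (S : finType) := MooreFamily {
  moore_sets : {set {set S}};
  moore_setT : setT \in moore_sets;
  moore_setI : forall A B,
    A \in moore_sets -> B \in moore_sets -> A :&: B \in moore_sets
}.

Record mooreType (S : finType) (C : mooreFamily S) := MooreType {
  moore_val :> {set S};
  _ : moore_val \in moore_sets C
}.

Section MooreLattice.
Variables (S : finType) (C : mooreFamily S).
Local Notation T := (mooreType C).

HB.instance Definition _ := [isSub for @moore_val S C].
HB.instance Definition _ := [Finite of mooreType C by <:].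

Implicit Types A B D : T.

Definition moore_le A B := (A : {set S}) \subset B.

Fact moore_le_refl : reflexive moore_le.
Proof. by move=> A; rewrite /moore_le subxx. Qed.

Fact moore_le_anti : antisymmetric moore_le.
Proof. by move=> A B AB; apply/val_inj/eqP; rewrite eqEsubset. Qed.

Fact moore_le_trans : transitive moore_le.
Proof. by move=> B A D; apply: subset_trans. Qed.

HB.instance Definition _ := Order.Le_isPOrder.Build
  Order.SetSubsetOrder.subset_display T
  moore_le_refl moore_le_anti moore_le_trans.

Definition moore_meet A B : T := MooreType (moore_setI (valP A) (valP B)).

Fact moore_closure_subproof (X : {set S}) :
  \bigcap_(A in moore_sets C | X \subset A) A \in moore_sets C.
Proof.
elim/big_ind: _; [exact: moore_setT|exact: moore_setI|by move=> A /andP[]].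
Qed.

Definition moore_closure (X : {set S}) : T :=
  MooreType (moore_closure_subproof X).

Definition moore_join A B : T := moore_closure (A :|: B).

Lemma moore_closureP (X : {set S}) A :
  (moore_closure X <= A)%O = (X \subset A).
Proof.
apply/idP/idP => [|XA]; last by apply: bigcap_inf; rewrite XA andbT (valP A).
by apply: subset_trans; apply/bigcapsP => B /andP[].
Qed.

Fact moore_meetP A B D :
  (A <= moore_meet B D)%O = (A <= B)%O && (A <= D)%O.
Proof. exact: subsetI. Qed.

Fact moore_joinP A B D :
  (moore_join A B <= D)%O = (A <= D)%O && (B <= D)%O.
Proof. by rewrite moore_closureP subUset. Qed.

HB.instance Definition _ := Order.POrder_MeetJoin_isLattice.Build
  Order.SetSubsetOrder.subset_display T moore_meetP moore_joinP.

Fact moore_le0x A : (moore_closure set0 <= A)%O.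
Proof. by rewrite moore_closureP sub0set. Qed.

HB.instance Definition _ := Order.hasBottom.Build
  Order.SetSubsetOrder.subset_display T moore_le0x.

Fact moore_lex1 A : (A <= MooreType (moore_setT C))%O.
Proof. exact: subsetT. Qed.

HB.instance Definition _ := Order.hasTop.Build
  Order.SetSubsetOrder.subset_display T moore_lex1.

End MooreLattice.

Section FaceAndFlatLattices.
Variables (S : finType) (M : orientedMatroid S).

Fact faces_setT : setT \in faces M.
Proof. by rewrite inE setCT cov_zero. Qed.

Fact faces_setI (F G : {set S}) :
  F \in faces M -> G \in faces M -> F :&: G \in faces M.
Proof.
rewrite !inE setCI => MF MG; have := cov_comp MF MG.
by rewrite /comp /= setD0 set0D setU0.
Qed.

Fact flats_setT : setT \in flats M.
Proof.
by apply/imsetP; exists (set0, set0); rewrite ?cov_zero // /support setU0 setC0.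
Qed.

Fact flats_setI (F G : {set S}) :
  F \in flats M -> G \in flats M -> F :&: G \in flats M.
Proof.
move=> /imsetP[u Mu ->] /imsetP[v Mv ->].
apply/imsetP; exists (comp u v); first exact: cov_comp.
rewrite -setCU; congr (~: _); apply/setP => s; rewrite !inE /=.
by case: (s \in u.1); case: (s \in u.2); case: (s \in v.1); case: (s \in v.2).
Qed.

Fact faces_flats (F : {set S}) : F \in faces M -> F \in flats M.
Proof.
rewrite inE => MF; apply/imsetP; exists (~: F, set0) => //.
by rewrite /support setU0 setCK.
Qed.

(* The faces form a lattice even if M is not acyclic; acyclicity says that
   the empty set is a face, hence the bottom of both lattices. *)
Definition face_family := MooreFamily faces_setT faces_setI.
Definition flat_family := MooreFamily flats_setT flats_setI.

Definition face_lattice := mooreType face_family.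
Definition flat_lattice := mooreType flat_family.

Definition flat_of_face (F : face_lattice) : flat_lattice :=
  @MooreType _ flat_family F (faces_flats (valP F)).

Lemma face_lattice_bot :
  acyclic M -> ((\bot%O : face_lattice) : {set S}) = set0.
Proof.
move=> acM; have M0 : set0 \in faces M by rewrite inE setC0.
apply/eqP; rewrite -subset0.
exact: (le0x (@MooreType _ face_family _ M0 : face_lattice)).
Qed.

Lemma flat_lattice_bot :
  acyclic M -> ((\bot%O : flat_lattice) : {set S}) = set0.
Proof.
move=> acM; have M0 : set0 \in faces M by rewrite inE setC0.
apply/eqP; rewrite -subset0.
exact: (le0x (@MooreType _ flat_family _ (faces_flats M0) : flat_lattice)).
Qed.

End FaceAndFlatLattices.

Section BuildingSets.
Variables (disp : Order.disp_t) (L : finTBLatticeType disp).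
Implicit Types (B X G H : {set L}) (Y : L).
Local Open Scope order_scope.

Definition lower Y := {Z : L | Z <= Y}.

Definition lower_bot Y : lower Y := exist _ \bot (le0x Y).

Definition max_below B Y : {set L} :=
  [set b in B | (b <= Y) && [forall c in B, (c <= Y) ==> ~~ (b < c)]].

Definition lower_prod B Y :=
  {dffun forall b : {b : L | b \in max_below B Y}, lower (val b)}.

(* x in the factor b, and \bot in all the other factors *)
Definition lower_inj B Y (b : {b : L | b \in max_below B Y})
    (x : lower (val b)) : lower_prod B Y :=
  finfun (dfwith (fun c : {b : L | b \in max_below B Y} => lower_bot (val c)) x).

Definition building_set B : Prop :=
  \bot \notin B /\
  forall Y, \bot < Y ->
    exists phi : lower_prod B Y -> lower Y,
      [/\ bijective phi,
          forall f g : lower_prod B Y,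
            val (phi f) <= val (phi g) <-> (forall b, val (f b) <= val (g b)) &
          forall b (x : lower (val b)), val (phi (lower_inj x)) = val x].

(* The inclusion-minimal building set containing X always exists and is unique
   (building sets are stable under intersection), so that it is determined by
   its minimality. *)
Definition building_closure X G : Prop :=
  [/\ building_set G, X \subset G &
      forall H, building_set H -> X \subset H -> H \subset G -> H = G].

End BuildingSets.

(* Main.v *)
Require Import Defs.
From HB Require Import structures.
From mathcomp Require Import all_boot all_order.

Set Implicit Arguments.
Unset Strict Implicit.
Unset Printing Implicit Defensive.

Import Defs Order.TTheory.

(** The building closure is bounded from above by an explicit building set
that adds no new face to F.  For a flat Y let hull Y be the smallest face
containing Y; the bound is the set H of the flats whose hull lies in F.  A
face is its own hull, so H contains F and every face in H is in F.

That H behaves like a building set is read off a description of building sets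
by two closure properties, valid in any family of subsets of S that is stable
under intersection and contains the empty set and all singletons, hence for
faces and for flats here.  Call A a separator of Y if the part of the lattice
below Y splits along Y = A + (Y \ A), that is, if members traced on A and on
Y \ A can be glued into a member.  The separators of Y form a Boolean algebra,
whose atoms (the components of Y) are connected, meaning without nontrivial
separators.  A set B of nonempty members is a building set if and only if it
contains the connected members and the join of any two of its members that
intersect: building_connected and building_join prove one direction,
building_of_joins the other.  These conditions pass to intersections, so the
minimality of the closure G gives G = G :&: H as soon as H satisfies them.

Joins are no problem, because hull commutes with joins (face_hull_join).  The
connected flats use the geometry (connected_face_hull): the maximal elements
of F below hull Y are separators of hull Y in the face lattice; once they are
known to be separators in the flat lattice as well, their traces on Y are
separators of Y, so a connected Y lies inside one of them, which is then
hull Y itself.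

The passage from face separators to flat separators (face_separator_flat) is
the oriented-matroid step.  If a face P splits into A and B in the face
lattice, any covector v can be replaced by one that agrees with v on A and
vanishes on B (vanish_face).  One climbs a maximal chain of faces from the
empty set to B, making v vanish on one face after the other by covector
elimination; if this failed between two consecutive faces, elimination would
produce a face strictly between them. *)

(** * Separators and connected components *)

Section Separators.
Variables (S : finType) (C : mooreFamily S).
Implicit Types A X Y Z W : {set S}.
Local Notation "'C" := (moore_sets C).

(** A splits the members below Y as a product: the trace on A of any member
and the trace on the rest of Y of any other one together form a member. *)
Definition separator Y A :=
  (A \subset Y) &&
  [forall Z in 'C, forall W in 'C, (Z :&: A) :|: (W :&: (Y :\: A)) \in 'C].

Lemma separatorP Y A :
  reflect (A \subset Y /\ forall Z W, Z \in 'C -> W \in 'C ->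
             (Z :&: A) :|: (W :&: (Y :\: A)) \in 'C)
          (separator Y A).
Proof.
apply: (iffP andP) => -[AY sepA]; split=> //.
  by move=> Z W CZ CW; move/forall_inP: sepA => /(_ Z CZ)/forall_inP/(_ W CW).
by apply/forall_inP => Z CZ; apply/forall_inP => W CW; apply: sepA.
Qed.

Lemma separator_refl Y : Y \in 'C -> separator Y Y.
Proof.
move=> CY; apply/separatorP; split=> // Z W CZ _.
by rewrite setDv setI0 setU0 moore_setI.
Qed.

Lemma separatorC Y A : separator Y A -> separator Y (Y :\: A).
Proof.
case/separatorP=> AY sepA; apply/separatorP; split=> [|Z W CZ CW].
  exact: subsetDl.
by rewrite setDDr setDv set0U (setIidPr AY) setUC sepA.
Qed.

(** Gluing Z and W along A' first and then gluing the result with W along A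
amounts to gluing Z and W along the intersection. *)
Lemma separatorI Y A A' :
  separator Y A -> separator Y A' -> separator Y (A :&: A').
Proof.
case/separatorP=> AY sepA /separatorP[AY' sepA']; apply/separatorP.
split=> [|Z W CZ CW]; first by rewrite subIset ?AY.
have := sepA _ _ (sepA' _ _ CZ CW) CW; congr (_ \in 'C).
apply/setP => s; rewrite !inE; have := subsetP AY s.
by case: (s \in A) => [/(_ isT) ->|_]; case: (s \in A'); case: (s \in Y);
   case: (s \in Z); case: (s \in W).
Qed.

Lemma separatorU Y A A' :
  separator Y A -> separator Y A' -> separator Y (A :|: A').
Proof.
move=> sepA sepA'.
have := separatorC (separatorI (separatorC sepA) (separatorC sepA')).
case/andP: sepA => AY _; case/andP: sepA' => AY' _.
by rewrite -setDUr setDDr setDv set0U (setIidPr _) // subUset AY AY'.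
Qed.

Lemma separator_trans Y X A : separator Y X -> separator X A -> separator Y A.
Proof.
case/separatorP=> XY sepX /separatorP[AX sepA]; apply/separatorP.
split=> [|Z W CZ CW]; first exact: subset_trans XY.
have := sepX _ _ (sepA _ _ CZ CW) CW; congr (_ \in 'C).
apply/setP => s; rewrite !inE; have := subsetP XY s; have := subsetP AX s.
case: (s \in A) => [/(_ isT) ->/(_ isT) ->|_].
  by rewrite !andbT !andbF !orbF.
by case: (s \in X) => [/(_ isT) ->|_]; case: (s \in W); case: (s \in Y);
   case: (s \in Z).
Qed.

Lemma separator_restrict Y X A :
  Y \in 'C -> Y \subset X -> separator X A -> separator Y (A :&: Y).
Proof.
move=> CY YX /separatorP[AX sepA]; apply/separatorP.
split=> [|Z W CZ CW]; first exact: subsetIr.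
have := sepA _ _ (moore_setI CZ CY) (moore_setI CW CY); congr (_ \in 'C).
apply/setP => s; rewrite !inE; have := subsetP YX s.
by case: (s \in Y) => [/(_ isT) ->|_]; case: (s \in A); case: (s \in X);
   case: (s \in W); case: (s \in Z).
Qed.

Definition connected Y :=
  Y != set0 /\ forall A, separator Y A -> A != set0 -> A = Y.

Definition component Y s := \bigcap_(A | separator Y A && (s \in A)) A.

Lemma mem_component Y s : s \in component Y s.
Proof. by apply/bigcapP => A /andP[]. Qed.

Lemma component_sub Y s A :
  separator Y A -> s \in A -> component Y s \subset A.
Proof. by move=> sepA As; apply: bigcap_inf; rewrite sepA. Qed.

Lemma component_separator Y s :
  Y \in 'C -> s \in Y -> separator Y (component Y s).
Proof.
move=> CY Ys.
have /setIidPr <- := component_sub (separator_refl CY) Ys.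
rewrite /component; elim/big_rec: _ => [|A B /andP[sepA _] sepB].
  by rewrite setIT separator_refl.
by rewrite setICA separatorI.
Qed.

(** A separator of the component of s is a separator of Y, so by minimality it
cannot be proper if it contains s; otherwise its complement contains s. *)
Lemma component_connected Y s :
  Y \in 'C -> s \in Y -> connected (component Y s).
Proof.
move=> CY Ys; have sepK := component_separator CY Ys; split.
  by apply/set0Pn; exists s; apply: mem_component.
have sub A : separator (component Y s) A -> s \in A -> A = component Y s.
  move=> sepA As; apply/eqP; rewrite eqEsubset; case/andP: (sepA) => -> _ /=.
  exact/component_sub/As/(separator_trans sepK).
move=> A sepA; have [As _|nAs /set0Pn[t At]] := boolP (s \in A).
  exact: sub.
have /setP/(_ t) : component Y s :\: A = component Y s.
  by apply: sub; rewrite ?separatorC // inE nAs mem_component.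
by rewrite inE At => /esym/negbT; case/andP: sepA => /subsetP ->.
Qed.

Lemma separator_mem Y A : set0 \in 'C -> Y \in 'C -> separator Y A -> A \in 'C.
Proof.
move=> C0 CY /separatorP[AY /(_ Y set0 CY C0)].
by rewrite set0I setU0 (setIidPr AY).
Qed.

End Separators.

(** * Building sets of lattices whose atoms are the singletons *)

Section BuildingCriterion.
Variables (S : finType) (C : mooreFamily S).
Hypotheses (C0 : set0 \in moore_sets C)
           (C1 : forall s, [set s] \in moore_sets C).
Local Notation T := (mooreType C).
Implicit Types (B : {set T}) (Y X b c : T).

Lemma moore_leE X Y : (X <= Y)%O = (val X \subset val Y).
Proof. by []. Qed.

Lemma moore_bot : val (\bot%O : T) = set0.
Proof. by apply/eqP; rewrite -subset0; apply: (le0x (MooreType C0 : T)). Qed.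

Lemma moore_bot_lt Y : (\bot < Y)%O = (val Y != set0).
Proof. by rewrite lt0x -moore_bot (inj_eq val_inj). Qed.

Lemma max_belowP B Y b :
  reflect [/\ b \in B, (b <= Y)%O &
              forall c, c \in B -> (c <= Y)%O -> (b <= c)%O -> c = b]
          (b \in max_below B Y).
Proof.
rewrite inE; apply: (iffP and3P) => -[Bb bY maxb]; split=> //.
  move=> c Bc cY bc; move/forall_inP: maxb => /(_ c Bc)/implyP/(_ cY).
  by rewrite lt_neqAle bc andbT negbK => /eqP.
apply/forall_inP => c Bc; apply/implyP => cY; apply/negP => bc.
by move: (bc); rewrite (maxb c Bc cY (ltW bc)) ltxx.
Qed.

Lemma max_below_ex B Y X :
  X \in B -> (X <= Y)%O -> exists2 b, b \in max_below B Y & (X <= b)%O.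
Proof.
move=> BX XY; pose P b := [&& b \in B, (b <= Y)%O & (X <= b)%O].
have PX : P X by rewrite /P BX XY lexx.
case: (arg_maxnP (fun b : T => #|b : {set S}|) PX) => b /and3P[Bb bY Xb] maxb.
exists b => //; apply/max_belowP; split=> // c Bc cY bc.
apply/val_inj/esym/eqP; rewrite eqEcard [_ \subset _]bc /=.
by apply: maxb; rewrite /P Bc cY (le_trans Xb).
Qed.

Section ProductElements.
Variables (B : {set T}) (Y : T).
Local Notation I := {b : T | b \in max_below B Y}.
Implicit Types (f g : lower_prod B Y) (i j : I).

Lemma lower_inj_diag i (x : lower (val i)) : lower_inj x i = x.
Proof. by rewrite ffunE dfwith_in. Qed.

Lemma lower_inj_out i j (x : lower (val i)) :
  i != j -> val (val (lower_inj x j)) = set0.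
Proof. by move=> ij; rewrite ffunE dfwith_out //; apply: moore_bot. Qed.

Lemma lower_inj_le i (x : lower (val i)) f :
  (val x <= val (f i))%O -> forall j, (val (lower_inj x j) <= val (f j))%O.
Proof.
move=> xf j; have [<-|ij] := eqVneq i j; first by rewrite lower_inj_diag.
by rewrite moore_leE lower_inj_out ?sub0set.
Qed.

End ProductElements.

Section BuildingProperties.
Variables (B : {set T}).
Hypothesis B_building : building_set B.
Local Notation I Y := {b : T | b \in max_below B Y}.

Lemma building_neq0 b : b \in B -> val b != set0.
Proof.
case: B_building => B0 _ Bb; rewrite -moore_bot (inj_eq val_inj).
by apply: contraNneq B0 => <-.
Qed.

(** What the isomorphism phi of a building set looks like on subsets of S: it
sends a family of parts to their union.  Indeed a point s of phi f spans an
atom, and the preimage g of that atom lies below f; some entry of g is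
nonempty (else g would be the preimage of the bottom), and it has to be {s}. *)
Lemma building_union Y : val Y != set0 ->
  exists phi : lower_prod B Y -> lower Y,
    [/\ injective phi,
        forall s, s \in val Y -> exists f, val (val (phi f)) = [set s],
        forall (i : I Y) (x : lower (val i)), val (phi (lower_inj x)) = val x &
        forall f s,
          s \in val (val (phi f)) = [exists i : I Y, s \in val (val (f i))]].
Proof.
rewrite -moore_bot_lt => Y0; case: B_building => _ /(_ Y Y0)[phi].
case=> -[psi phiK psiK] phi_le phi_inj; exists phi.
have phi1 s : s \in val Y -> exists f, val (val (phi f)) = [set s].
  move=> Ys; have sY : (MooreType (C1 s) <= Y)%O by rewrite moore_leE sub1set.
  by exists (psi (exist _ (MooreType (C1 s)) sY)); rewrite psiK.
split=> //; first exact: can_inj phiK.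
have phi_ge (f : lower_prod B Y) (i : I Y) : (val (f i) <= val (phi f))%O.
  rewrite -(phi_inj i (f i)); apply/phi_le.
  exact: lower_inj_le.
move=> f s; apply/idP/existsP => [fs|[i]]; last exact: (subsetP (phi_ge f i)).
have [|g phig] := phi1 s; first exact: (subsetP (valP (phi f))).
have gf i : (val (g i) <= val (f i))%O.
  by apply/phi_le: i; rewrite moore_leE phig sub1set.
have [i gi|g0] := pickP (fun i : I Y => val (val (g i)) != set0).
  exists i; apply: (subsetP (gf i)); have := phi_ge g i.
  by rewrite moore_leE phig subset1 (negPf gi) orbF => /eqP->; rewrite set11.
have /phi_le : forall i, (val (g i) <= val (psi (lower_bot Y) i))%O.
  by move=> i; rewrite moore_leE; have /negbFE/eqP-> := g0 i; apply: sub0set.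
by rewrite psiK moore_leE phig moore_bot sub1set inE.
Qed.

Lemma max_below_inh b Y s : b \in max_below B Y -> s \in val b ->
  val Y != set0.
Proof.
by case/max_belowP=> _ bY _ bs; apply/set0Pn; exists s; apply: (subsetP bY).
Qed.

(** If two distinct maximal elements shared s, placing {s} in either factor
would give two preimages of {s}. *)
Lemma max_below_disjoint Y b c s :
  b \in max_below B Y -> c \in max_below B Y ->
  s \in val b -> s \in val c -> b = c.
Proof.
move=> Yb Yc bs cs.
have [phi [phi_inj _ phiE _]] := building_union (max_below_inh Yb bs).
have sb : (MooreType (C1 s) <= b)%O by rewrite moore_leE sub1set.
have sc : (MooreType (C1 s) <= c)%O by rewrite moore_leE sub1set.
pose i : I Y := exist _ b Yb; pose j : I Y := exist _ c Yc.
pose x : lower (val i) := exist _ (MooreType (C1 s)) sb.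
pose y : lower (val j) := exist _ (MooreType (C1 s)) sc.
have /phi_inj/ffunP/(_ i) : phi (lower_inj x) = phi (lower_inj y).
  by apply: val_inj; rewrite !phiE.
move/(congr1 (fun z => val (val z))); rewrite lower_inj_diag.
have [/(congr1 val) cb _|ji] := eqVneq j i; last first.
  by rewrite lower_inj_out // => /setP/(_ s); rewrite !inE eqxx.
exact/esym/cb.
Qed.

Lemma max_below_cover Y s :
  s \in val Y -> exists2 b, b \in max_below B Y & s \in val b.
Proof.
move=> Ys; have Y0 : val Y != set0 by apply/set0Pn; exists s.
have [phi [_ phi1 _ phiE]] := building_union Y0.
have [f phif] := phi1 s Ys; have := phiE f s; rewrite phif set11.
case/esym/existsP=> i fs; exists (val i); first exact: (valP i).
exact: (subsetP (valP (f i))).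
Qed.

(** Gluing Z and W along b is the image under the isomorphism of the family
that is the trace of Z in the factor b and the trace of W in the others. *)
Lemma max_below_separator Y b :
  b \in max_below B Y -> separator C (val Y) (val b).
Proof.
move=> Yb; have /max_belowP[Bb bY _] := Yb.
have /set0Pn[t bt] := building_neq0 Bb.
have [phi [_ _ _ phiE]] := building_union (max_below_inh Yb bt).
apply/separatorP; split=> // Z W CZ CW.
have Cif (i : I Y) : (if val i == b then Z else W) \in moore_sets C.
  by case: ifP.
pose part (i : I Y) : T := MooreType (moore_setI (Cif i) (valP (val i))).
have partP i : (part i <= val i)%O by apply: subsetIr.
pose f : lower_prod B Y := finfun (fun i : I Y => exist _ (part i) (partP i)).
suff <- : val (val (phi f)) = (Z :&: val b) :|: (W :&: (val Y :\: val b)).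
  exact: valP.
apply/setP => s; rewrite phiE !inE; apply/existsP/idP => [[i]|].
  rewrite ffunE inE; case: eqP => [->|/eqP ib] /andP[-> is_].
    by rewrite is_.
  have /max_belowP[_ /subsetP/(_ s is_) -> _] := valP i.
  have [bs|_] := boolP (s \in val b); last by rewrite orbT.
  by case/eqP: ib; apply: max_below_disjoint (valP i) Yb is_ bs.
case/orP=> [/andP[Zs bs]|/and3P[Ws nbs Ys]].
  by exists (exist _ b Yb); rewrite ffunE inE /= eqxx Zs.
have [c Yc cs] := max_below_cover Ys.
exists (exist _ c Yc); rewrite ffunE inE /= cs andbT.
by case: eqP cs => // ->; rewrite (negPf nbs).
Qed.

Lemma building_connected Y : connected C (val Y) -> Y \in B.
Proof.
case=> /set0Pn[s Ys] connY; have [b Yb bs] := max_below_cover Ys.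
suff -> : Y = b by case/max_belowP: Yb.
apply/val_inj/esym/connY; first exact: max_below_separator.
by apply/set0Pn; exists s.
Qed.

(** The maximal elements above X and above Y in B below their join intersect,
hence coincide, and so contain the join. *)
Lemma building_join X Y s :
  X \in B -> Y \in B -> s \in val X -> s \in val Y -> (X `|` Y)%O \in B.
Proof.
move=> BX BY Xs Ys.
have [b maxb Xb] := max_below_ex BX (leUl X Y).
have [c maxc Yc] := max_below_ex BY (leUr Y X).
have bc : b = c.
  exact: max_below_disjoint maxb maxc (subsetP Xb s Xs) (subsetP Yc s Ys).
have /max_belowP[Bb bXY _] := maxb.
suff -> : (X `|` Y = b)%O by [].
by apply/le_anti; rewrite bXY leUx Xb bc Yc.
Qed.

End BuildingProperties.

Section BuildingFromJoins.
Variable B : {set T}.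
Hypotheses (B0 : \bot%O \notin B)
  (B_connected : forall Y, connected C (val Y) -> Y \in B)
  (B_join : forall X Y s, X \in B -> Y \in B -> s \in val X -> s \in val Y ->
     (X `|` Y)%O \in B).
Local Notation I Y := {b : T | b \in max_below B Y}.

Lemma max_join_eq Y b c s : b \in max_below B Y -> c \in B -> (c <= Y)%O ->
  s \in val b -> s \in val c -> (c <= b)%O.
Proof.
case/max_belowP=> Bb bY maxb Bc cY bs cs.
by rewrite -(maxb _ (B_join Bb Bc bs cs)) ?leUr ?leUl // leUx bY.
Qed.

Lemma component_max Y s : s \in val Y ->
  exists X : T, [/\ val X = component C (val Y) s, X \in B & (X <= Y)%O].
Proof.
move=> Ys; have sepK := component_separator (valP Y) Ys.
exists (MooreType (separator_mem C0 (valP Y) sepK)); split=> //.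
  exact/B_connected/(component_connected (valP Y) Ys).
by rewrite moore_leE; case/andP: (sepK).
Qed.

Lemma join_max_cover Y s :
  s \in val Y -> exists i : I Y, s \in val (val i).
Proof.
move=> Ys; have [X [XE BX XY]] := component_max Ys.
have [b Yb Xb] := max_below_ex BX XY; exists (exist _ b Yb).
by apply: (subsetP Xb); have := mem_component C (val Y) s; rewrite -XE.
Qed.

(** A maximal element contains every component of Y that it meets, since its
join with that component stays in B; so it is a union of components. *)
Lemma join_max_separator Y b :
  b \in max_below B Y -> separator C (val Y) (val b).
Proof.
move=> Yb; have /max_belowP[_ bY _] := Yb.
have -> : val b = \bigcup_(s in val b) component C (val Y) s.
  apply/eqP; rewrite eqEsubset; apply/andP; split.
    by apply/subsetP => s bs; apply/bigcupP; exists s; rewrite ?mem_component.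
  apply/bigcupsP => s bs.
  have [X [XE BX XY]] := component_max (subsetP bY s bs).
  rewrite -XE; apply: max_join_eq Yb BX XY bs _.
  by rewrite XE mem_component.
elim/big_rec: _ => [|s A bs sepA].
  have := separatorC (separator_refl (valP Y)); by rewrite setDv.
apply: separatorU => //.
exact: component_separator (valP Y) (subsetP bY s bs).
Qed.

(** A binary gluing along each maximal element in turn makes the whole union
of parts a member of the family. *)
Lemma union_of_parts Y (f : lower_prod B Y) :
  \bigcup_(i : I Y) val (val (f i)) \in moore_sets C.
Proof.
have fi (i : I Y) s : s \in val (val (f i)) -> s \in val (val i).
  exact: (subsetP (valP (f i))).
have key : forall r : seq (I Y), uniq r ->
   \bigcup_(i <- r) val (val (f i)) \in moore_sets C.
  elim=> [|i r IHr] /=; first by rewrite big_nil.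
  case/andP=> ir /IHr Cr; rewrite big_cons.
  have /separatorP[iY glue] := join_max_separator (valP i).
  have := glue _ _ (valP (val (f i))) Cr.
  congr (_ \in moore_sets C); rewrite (setIidPl _); last exact: (valP (f i)).
  congr (_ :|: _); rewrite bigcup_seq; apply/setIidPl/bigcupsP => j jr.
  apply/subsetP => s /fi js; rewrite inE.
  have /max_belowP[Bj jY _] := valP j; have Yi := valP i.
  rewrite [_ \in val Y](subsetP jY) // andbT; apply: contra ir => is_.
  suff -> : i = j by [].
  have /max_belowP[Bi _ maxi] := Yi; apply/val_inj/esym.
  have /max_belowP[_ iY' _] := Yi.
  apply: le_anti; rewrite (max_join_eq Yi Bj jY is_ js).
  by rewrite (max_join_eq (valP j) Bi iY' js is_).
exact/key/index_enum_uniq.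
Qed.

Lemma building_of_joins : building_set B.
Proof.
split=> // Y _.
pose U (f : lower_prod B Y) : T := MooreType (union_of_parts f).
have UY f : (U f <= Y)%O.
  apply/bigcupsP => i _; apply: le_trans (valP (f i)) _.
  by have /max_belowP[] := valP i.
have partP (g : lower Y) (i : I Y) : (val g `&` val i <= val i)%O.
  exact: leIr.
pose phi f : lower Y := exist _ (U f) (UY f).
pose psi g : lower_prod B Y :=
  finfun (fun i => exist _ (val g `&` val i)%O (partP g i)).
have disj (i j : I Y) s : s \in val (val i) -> s \in val (val j) -> i = j.
  move=> is_ js; apply/val_inj; have Yi := valP i; have Yj := valP j.
  have /max_belowP[Bi iY _] := Yi; have /max_belowP[Bj jY _] := Yj.
  apply: le_anti; rewrite (max_join_eq Yi Bj jY is_ js).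
  by rewrite (max_join_eq Yj Bi iY js is_).
have UI f (i : I Y) : val (U f) :&: val (val i) = val (val (f i)).
  apply/setP => s; rewrite inE; apply/andP/idP => [[/bigcupP[j _ fs] is_]|fs].
    by rewrite (disj i j s) // (subsetP (valP (f j))).
  by rewrite (subsetP (valP (f i))) //; split=> //; apply/bigcupP; exists i.
exists phi; split.
- exists psi => [f|g].
    by apply/ffunP => i; rewrite ffunE; apply/val_inj/val_inj; apply: UI.
  apply/val_inj/val_inj/setP => s; apply/bigcupP/idP => [[i _]|gs].
    by rewrite ffunE => /setIP[].
  have [i is_] := join_max_cover (subsetP (valP g) s gs).
  by exists i => //; rewrite ffunE inE gs.
- move=> f g; split=> [fg i|fg].
    by rewrite moore_leE -!UI setSI.
  apply/subsetP => s /bigcupP[i _ fs]; apply/bigcupP.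
  by exists i => //; apply: (subsetP (fg i)).
move=> i x; apply/val_inj/setP => s; apply/bigcupP/idP => [[j _]|xs].
  have [<-|ij] := eqVneq i j; first by rewrite lower_inj_diag.
  by rewrite lower_inj_out // inE.
by exists i => //; rewrite lower_inj_diag.
Qed.

End BuildingFromJoins.
End BuildingCriterion.

(** * Face separators are flat separators *)

Section FaceSeparators.
Variables (S : finType) (M : orientedMatroid S).
Hypothesis M_acyclic : acyclic M.
Implicit Types (u v w : {set S} * {set S}) (A B P X Y Z W : {set S}).
Local Notation covec v := (v \in covectors M).

Local Notation vanish v B := [disjoint support v & B].

Definition agree A v w := v.1 :&: A = w.1 :&: A /\ v.2 :&: A = w.2 :&: A.

Lemma agree_trans A u v w : agree A u v -> agree A v w -> agree A u w.
Proof. by case=> uv1 uv2 [vw1 vw2]; split; rewrite ?uv1 ?uv2. Qed.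

Lemma vanishP v B :
  reflect (forall s, s \in B -> s \notin v.1 /\ s \notin v.2) (vanish v B).
Proof.
rewrite disjoint_sym disjoint_subset; apply: (iffP subsetP) => vB s /vB.
  by rewrite !inE => /norP.
by case=> v1 v2; rewrite !inE; apply/norP.
Qed.

Lemma covec_disjoint v s : covec v -> s \in v.1 -> s \in v.2 -> false.
Proof. by move/cov_disjoint/disjointFr => v12 /v12 ->. Qed.

Lemma elimination u v e : covec u -> covec v -> e \in sep u v ->
  exists w, [/\ covec w, e \notin support w &
    forall s, s \notin sep u v ->
      (s \in w.1) = (s \in u.1) || (s \notin u.2) && (s \in v.1) /\
      (s \in w.2) = (s \in u.2) || (s \notin u.1) && (s \in v.2)].
Proof.
move=> Mu Mv /(cov_elim Mu Mv)[w Mw [we w1 w2]]; exists w; split=> // s nsep.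
move/setP/(_ s): w1; move/setP/(_ s): w2.
by rewrite !in_setD nsep /= => -> ->; rewrite !inE.
Qed.

(** In a realization, this adds to the functional w the multiple of the
positive covector with zero set A :|: B that makes its minimum on B' :\: B
zero.  Combinatorially, eliminating one negative element of w against w
perturbed by that positive covector creates no new negative element in B', so
the negative part of w in B' can be exhausted; the element eliminated last is
a zero of the result. *)
Lemma eliminate_negatives A B B' w :
  A :|: B \in faces M -> B \subset B' -> [disjoint A & B'] ->
  covec w -> vanish w B -> w.2 :&: B' != set0 ->
  exists z e, [/\ covec z, agree A w z, vanish z B, z.2 :&: B' = set0 &
                  e \in B' :\: B /\ e \notin support z].
Proof.
move=> MAB /subsetP BB' AB'.
have [n] := ubnP #|w.2 :&: B'|; elim: n w => // n IHn w; rewrite ltnS => wn.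
move=> Mw /vanishP w0 /set0Pn[e /setIP[w2e B'e]].
have nAB' s : s \in A -> s \notin B' by move/(disjointFr AB') ->.
have nw12 s : s \in w.1 -> s \in w.2 -> false by apply: covec_disjoint.
(* u is w made positive outside A :|: B. *)
have [u [Mu u1 u2]] : exists u, [/\ covec u,
    forall s, (s \in u.1) = (s \notin A) && (s \notin B) || (s \in w.1) &
    forall s, (s \in u.2) = ((s \in A) || (s \in B)) && (s \in w.2)].
  rewrite inE in MAB; exists (comp (~: (A :|: B), set0) w).
  split=> [|s|s]; first exact: cov_comp.
    by rewrite !inE negb_or.
  by rewrite !inE negbK.
have sepE s : (s \in sep w u) = [&& s \in w.2, s \notin A & s \notin B].
  rewrite !inE u1 u2; have := w0 s; have := nw12 s.
  case: (s \in w.1); case: (s \in w.2); case: (s \in A); case: (s \in B) => //=;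
    by move/(_ isT isT).
have [|z [Mz ze zE]] := elimination Mw Mu (e := e).
  rewrite sepE w2e /=; apply/andP; split.
    by apply/negP => /nAB'; rewrite B'e.
  by apply/negP => /w0[_]; rewrite w2e.
have Az : agree A w z.
  split; apply/setP => s; rewrite !inE; case As: (s \in A); rewrite ?andbF //=.
    have [|-> _] := zE s; first by rewrite sepE As andbF.
    by rewrite u1 As /=; case: (s \in w.1); rewrite ?andbF.
  have [|_ ->] := zE s; first by rewrite sepE As andbF.
  by rewrite u2 As /=; case: (s \in w.2); rewrite ?andbF.
have z0 : vanish z B.
  apply/vanishP => s Bs; have [w1 w2] := w0 s Bs.
  have [|-> ->] := zE s; first by rewrite sepE Bs !andbF.
  by rewrite u1 u2 Bs (negPf w1) (negPf w2) !andbF.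
have zw : z.2 :&: B' \proper w.2 :&: B'.
  apply/properP; split; last first.
    exists e; rewrite !inE ?w2e //; apply: contra ze => /andP[z2e _].
    by rewrite inE z2e orbT.
  apply/subsetP => s; rewrite !inE => /andP[z2s B's]; rewrite B's andbT.
  apply: contraLR z2s => w2s; have [|_ ->] := zE s.
    by rewrite sepE (negPf w2s).
  by rewrite u2 (negPf w2s) !andbF.
have Be : e \notin B by apply/negP => /w0[_]; rewrite w2e.
have [zB|zB] := eqVneq (z.2 :&: B') set0.
  by exists z, e; split=> //; rewrite inE Be B'e.
have [|y [f [My Ay y0 yB yf]]] := IHn z _ Mz z0 zB.
  exact: leq_trans (proper_card zw) wn.
by exists y, f; split=> //; apply: agree_trans Az _.
Qed.

(** When B' covers B among the faces, the covector z obtained by eliminating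
negatives vanishes on all of B': composing the positive covector of B' with z
shows that the zeros of z in B' form a face, which contains B strictly. *)
Lemma vanish_next_face A B B' v :
  A :|: B \in faces M -> B' \in faces M -> B \proper B' -> [disjoint A & B'] ->
  (forall X, X \in faces M -> B \subset X -> X \proper B' -> X = B) ->
  covec v -> vanish v B ->
  exists z, [/\ covec z, agree A v z & vanish z B'].
Proof.
move=> MAB MB' BB' AB' B'min Mv v0; have sBB' := proper_sub BB'.
(* Made negative outside A :|: B, v has negative elements to eliminate. *)
pose w := comp (set0, ~: (A :|: B)) v.
have Mw : covec w.
  by rewrite inE in MAB; apply: cov_comp Mv; have := cov_opp MAB.
have Aw : agree A v w.
  split; apply/setP => s; rewrite !inE;
  by case: (s \in A); rewrite ?andbF //= ?andbT.
have w0 : vanish w B.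
  apply/vanishP => s Bs; case/vanishP/(_ s Bs): v0 => v1 v2.
  by rewrite !inE Bs (negPf v1) (negPf v2) orbT.
have wB' : w.2 :&: B' != set0.
  case/properP: BB' => _ [s B's nBs]; apply/set0Pn; exists s.
  by rewrite !inE B's (negPf nBs) orbF andbT (disjointFl AB' B's).
have [z [e [Mz Az z0 zB' [Be ze]]]] :=
  eliminate_negatives MAB sBB' AB' Mw w0 wB'.
exists z; split=> //; first exact: agree_trans Aw Az.
have MX : B' :\: z.1 \in faces M.
  rewrite !inE in MB' *.
  suff <- : comp (~: B', set0) z = (~: (B' :\: z.1), set0) by apply: cov_comp.
  by rewrite /comp /= setD0 set0U setDE setCK zB' setCD.
have [/setDidPl z1B'|XB'] := eqVneq (B' :\: z.1) B'.
  by rewrite -setI_eq0 setIUl zB' setU0 setIC setI_eq0 z1B'.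
have XB : B' :\: z.1 = B.
  apply: B'min; rewrite ?properEneq ?XB' ?subsetDl //.
  rewrite subsetD sBB' /= disjoint_sym.
  by apply: disjointWl z0; apply: subsetUl.
move: Be; rewrite -XB !inE negb_and negbK => /andP[/orP[z1e|/negP//] _].
by case/negP: ze; rewrite inE z1e.
Qed.

(** The zeros in B are enlarged one covering relation of faces at a time,
starting from the empty face, which exists by acyclicity. *)
Lemma vanish_face A B v :
  B \in faces M -> [disjoint A & B] ->
  (forall X, X \in faces M -> X \subset B -> A :|: X \in faces M) ->
  covec v -> exists z, [/\ covec z, agree A v z & vanish z B].
Proof.
move=> MB AB MA Mv.
suff step n X w : #|B| - #|X| < n -> X \in faces M -> X \subset B ->
    covec w -> vanish w X -> exists z, [/\ covec z, agree A w z & vanish z B].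
  apply: (step _ set0) Mv _ => //; rewrite ?sub0set ?inE ?setC0 //.
  by apply/vanishP => s; rewrite inE.
elim: n => // n IHn in X w *; rewrite ltnS => nX MX XB Mw w0.
have [XeqB|nXB] := eqVneq X B; first by exists w; rewrite -XeqB.
pose P Y := [&& Y \in faces M, X \proper Y & Y \subset B].
have PB : P B by rewrite /P MB properEneq nXB XB subxx.
case: (arg_minnP (fun Y : {set S} => #|Y|) PB) => Y /and3P[MY XY YB] Ymin.
have AY : [disjoint A & Y] by apply: disjointWr AB.
have [|z [Mz Az z0]] := vanish_next_face (MA X MX XB) MY XY AY _ Mw w0.
  move=> X' MX' XX' X'Y; apply/eqP; rewrite eq_sym; apply: contraTT isT => nXX'.
  have /Ymin : P X'.
    by rewrite /P MX' properEneq nXX' XX' (subset_trans (proper_sub X'Y)).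
  by rewrite leqNgt (proper_card X'Y).
have [|y [My Ay y0]] := IHn Y z _ MY YB Mz z0.
  apply: leq_trans nX; apply: ltn_sub2l (proper_card XY).
  exact: leq_trans (proper_card XY) (subset_leq_card YB).
by exists y; split=> //; apply: agree_trans Az Ay.
Qed.

(** If v and w have zero sets Z and W, let a agree with v on A and vanish on
the rest B of P, and let b agree with w on B and vanish on A: the composition
of the positive covector of P with a and b has as zeros the gluing of Z and W
along A. *)
Lemma face_separator_flat P A :
  P \in faces M -> separator (face_family M) P A ->
  separator (flat_family M) P A.
Proof.
move=> MP sepA; have M0 : set0 \in faces M by rewrite inE setC0.
have MA := separator_mem (C := face_family M) M0 MP sepA.
have MB := separator_mem (C := face_family M) M0 MP (separatorC sepA).
case/separatorP: sepA => AP sepA; set B := P :\: A in sepA MB *.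
have AB : [disjoint A & B] by rewrite disjoints_subset setCD subsetUr.
apply/separatorP; split=> // _ _ /imsetP[v Mv ->] /imsetP[w Mw ->].
have [X MX XB|a [Ma [va1 va2] /vanishP a0]] := vanish_face MB AB _ Mv.
  by have := sepA _ _ MP MX; rewrite (setIidPr AP) (setIidPl XB).
rewrite disjoint_sym in AB.
have [X MX XA|b [Mb [wb1 wb2] /vanishP b0]] := vanish_face MA AB _ Mw.
  have := sepA _ _ MX MP.
  by rewrite (setIidPl XA) (setIidPr (subsetDl _ _)) setUC.
rewrite inE in MP; apply/imsetP; exists (comp (~: P, set0) (comp a b)).
  by rewrite !cov_comp.
apply/setP => s; rewrite !inE.
have := a0 s; have := b0 s; have := subsetP AP s; rewrite !inE.
move/setP/(_ s): va1; move/setP/(_ s): va2.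
move/setP/(_ s): wb1; move/setP/(_ s): wb2.
rewrite !inE; case: (s \in A) => /=.
  rewrite !andbT !andbF !orbF => _ _ -> ->.
  move=> /(_ isT) -> /(_ isT)[/negPf-> /negPf->] _ /=.
  by rewrite !andbF !orbF.
move=> wb2' wb1' _ _ _ _; move: wb2' wb1'; case: (s \in P) => /=.
  by rewrite !andbT !andbF => -> -> /(_ isT)[/negPf-> /negPf->].
by rewrite !andbF.
Qed.

End FaceSeparators.

(** * Smallest faces containing flats *)

Section FaceHull.
Variables (S : finType) (M : orientedMatroid S).
Hypotheses (M_acyclic : acyclic M) (M_elements : forall s, [set s] \in faces M).
Implicit Types X Y : flat_lattice M.

Definition face_hull Y : face_lattice M :=
  moore_closure (face_family M) (val Y).

Lemma face_hullP Y (K : face_lattice M) :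
  (face_hull Y <= K)%O = (val Y \subset val K).
Proof. exact: moore_closureP. Qed.

Lemma sub_face_hull Y : val Y \subset val (face_hull Y).
Proof. by rewrite -face_hullP. Qed.

Lemma face_hull_id (K : face_lattice M) : face_hull (flat_of_face K) = K.
Proof.
apply: le_anti; rewrite face_hullP subxx.
exact: (sub_face_hull (flat_of_face K)).
Qed.

(** Faces are flats, so a face that contains X and Y contains their join in
the lattice of flats. *)
Lemma face_hull_join X Y :
  face_hull (X `|` Y)%O = (face_hull X `|` face_hull Y)%O.
Proof.
apply: le_anti; apply/andP; split; last first.
  rewrite leUx !face_hullP; apply/andP; split.
    by apply: subset_trans (sub_face_hull _); apply: (leUl X Y).
  by apply: subset_trans (sub_face_hull _); apply: (leUr Y X).
rewrite face_hullP; set K := (face_hull X `|` _)%O.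
suff : (X `|` Y <= flat_of_face K)%O by [].
rewrite leUx; apply/andP; split.
  exact/(subset_trans (sub_face_hull X))/(leUl (face_hull X) (face_hull Y)).
exact/(subset_trans (sub_face_hull Y))/(leUr (face_hull Y) (face_hull X)).
Qed.

Let faces0 : set0 \in moore_sets (face_family M).
Proof. by rewrite inE setC0. Qed.

(** The trace on Y of a maximal element of F below the hull is a separator of
Y, so one of these maximal elements contains Y and is therefore the hull. *)
Lemma connected_face_hull (F : {set face_lattice M}) Y :
  building_set F -> connected (flat_family M) (val Y) -> face_hull Y \in F.
Proof.
move=> F_building [/set0Pn[s Ys] connY].
have [b Yb bs] := max_below_cover faces0 M_elements F_building
  (subsetP (sub_face_hull Y) s Ys).
have /max_belowP[Fb bY _] := Yb.
have sepb := max_below_separator faces0 M_elements F_building Yb.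
have sepbY := separator_restrict (valP Y) (sub_face_hull Y)
  (face_separator_flat M_acyclic (valP (face_hull Y)) sepb).
have /setIidPr Yb' : val b :&: val Y = val Y.
  by apply: connY sepbY _; apply/set0Pn; exists s; rewrite inE bs.
suff -> : face_hull Y = b by [].
by apply: le_anti; rewrite bY face_hullP Yb'.
Qed.

End FaceHull.

Theorem proposition14p9 (S : finType) (M : orientedMatroid S)
  (M_acyclic : acyclic M)
  (M_elements : forall s : S, [set s] \in faces M)
  (F : {set face_lattice M}) (F_building : building_set F)
  (G : {set flat_lattice M})
  (G_closure : building_closure (flat_of_face (M := M) @: F) G) :
  G :&: (flat_of_face (M := M) @: [set: face_lattice M])
    = flat_of_face (M := M) @: F.
Proof.
have K0 : set0 \in moore_sets (face_family M) by rewrite inE setC0.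
have K1 s : [set s] \in moore_sets (face_family M) := M_elements s.
have C0 : set0 \in moore_sets (flat_family M) := faces_flats K0.
have C1 s : [set s] \in moore_sets (flat_family M) := faces_flats (K1 s).
case: G_closure => G_building FG G_min.
have GH : G \subset [set Y | face_hull Y \in F].
  (* By minimality of G it is enough that the intersection is a building set. *)
  apply/setIidPl/G_min; last exact: subsetIl.
    have [bG _] := G_building.
    apply: (building_of_joins C0) => [|Y connY|X Y s].
    - by rewrite inE (negPf bG).
    - rewrite !inE (building_connected C0 C1 G_building connY) /=.
      exact: connected_face_hull.
    rewrite !inE => /andP[GX FX] /andP[GY FY] Xs Ys.
    rewrite (building_join C0 C1 G_building GX GY Xs Ys) face_hull_join.
    apply: (building_join K0 K1 F_building FX FY (s := s)).
      exact: (subsetP (sub_face_hull X)).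
    exact: (subsetP (sub_face_hull Y)).
  rewrite subsetI FG; apply/subsetP => _ /imsetP[K FK ->].
  by rewrite inE face_hull_id.
apply/setP => Y; rewrite inE; apply/andP/idP => [[GY /imsetP[K _ YK]]|FY].
  move/(subsetP GH): GY; rewrite inE YK face_hull_id => FK.
  exact: imset_f.
split; first exact: (subsetP FG).
by case/imsetP: FY => K _ ->; apply: imset_f; rewrite inE.
Qed.
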